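(* For all integers $r\geq 2$ and $m,j\geq 0$, we have $$T_{j+1,r}(m)-T_{j,r}(m)=\sum_{\lambda\in\mathcal{D}_{j,r}(m)}\bar{\ell}(\lambda)-\sum_{\lambda\in\mathcal{O}_{j,r}(m)}\bar{\ell}(\lambda),$$ where $\bar{\ell}(\lambda)$ is the number of distinct colored parts in $\lambda$ (i.e. counted without multiplicity).
   Context: A colored part is a symbol $n_i$ with $n,i$ integers and $1\le i\le n$; $n$ is called its size and $i$ its subscript (or color). Two colored parts $n_i$ and $n'_{i'}$ are equal if and only if $n=n'$ and $i=i'$. An $n$-color partition of a non-negative integer $m$ is a finite multiset of colored parts whose sizes (counted with multiplicity) sum to $m$; the only $n$-color partition of $0$ is the empty one. The multiplicity of a colored part in an $n$-color partition is the number of times it occurs in it. For example, the six $n$-color partitions of $3$ are $(1_1,1_1,1_1)$, $(2_1,1_1)$, $(2_2,1_1)$, $(3_1)$, $(3_2)$, $(3_3)$. For integers $r\ge 2$ and $j,m\ge 0$: - $\mathcal{O}_{j,r}(m)$ is the set of $n$-color partitions of $m$ with exactly $j$ different colored parts (counted without multiplicity; each may be repeated) whose size and subscript are both divisible by $r$. - $\mathcal{D}_{j,r}(m)$ is the set of $n$-color partitions of $m$ with exactly $j$ different colored parts (counted without multiplicity) that occur with multiplicity at least $r$. - $T_{j,r}(m)$ is the total number of distinct colored parts with multiplicity strictly greater than $r$ and strictly less than $2r$ in all partitions in $\mathcal{D}_{j,r}(m)$; that is, the sum over $\lambda\in\mathcal{D}_{j,r}(m)$ of the number of distinct colored parts of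 $\lambda$ whose multiplicity in $\lambda$ is greater than $r$ and less than $2r$. *)

(* Defs.v *)
From HB Require Import structures.
From mathcomp Require Import all_boot all_order all_algebra.
From mathcomp Require Import finmap multiset.
From mathcomp Require Import boolp classical_sets functions cardinality fsbigop.

Set Implicit Arguments.
Unset Strict Implicit.
Unset Printing Implicit Defensive.

Import GRing.Theory.
Local Open Scope fset_scope.
Local Open Scope mset_scope.
Local Open Scope classical_set_scope.
Local Open Scope nat_scope.

(* The colored part n_i is the pair (n, i). *)
Record cpart : Type :=
  CPart { cpair : nat * nat; cpairP : 0 < cpair.2 <= cpair.1 }.

HB.instance Definition _ := [isSub for cpair].
HB.instance Definition _ := [Countable of cpart by <:].

Definition psize (p : cpart) : nat := (cpair p).1.
Definition pcolor (p : cpart) : nat := (cpair p).2.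

(* For l : {mset cpart}, l p is the multiplicity of p in l, finsupp l is the
   finite set of distinct parts of l, and enum_mset l lists the parts of l
   with repetition. *)
Definition weight (l : {mset cpart}) : nat := \sum_(p <- enum_mset l) psize p.

Definition ncolor_partitions (m : nat) : set {mset cpart} :=
  [set l | weight l = m].

Definition num_parts (l : {mset cpart}) : nat := #|` finsupp l|.

Definition Oset (j r m : nat) : set {mset cpart} :=
  [set l | ncolor_partitions m l /\
     #|` [fset p in finsupp l | (r %| psize p) && (r %| pcolor p)]| = j].

Definition Dset (j r m : nat) : set {mset cpart} :=
  [set l | ncolor_partitions m l /\
     #|` [fset p in finsupp l | r <= l p]| = j].

Definition Tnum (j r m : nat) : int :=
  (\sum_(l \in Dset j r m) #|` [fset p in finsupp l | (r < l p < 2 * r)%N]|%:Z)%R.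

(* A sum \sum_(l \in A) F l is 0 by convention when infinitely many terms are
   nonzero; the lemmas below show that this never happens here. *)
Lemma weightE (l : {mset cpart}) :
  weight l = \sum_(p <- finsupp l) l p * psize p.
Proof. by rewrite /weight sum_mset; apply: eq_bigr => p _; rewrite mulnC. Qed.

Lemma leq_weight (l : {mset cpart}) (p : cpart) : l p * psize p <= weight l.
Proof.
case: (finsuppP l p) => [|pl]; first by rewrite mul0n.
by rewrite weightE (big_fsetD1 p pl) /= leq_addr.
Qed.

Lemma psize_gt0 (p : cpart) : 0 < psize p.
Proof. by have /andP[] := cpairP p; apply: leq_trans. Qed.

Lemma pcolor_le (p : cpart) : pcolor p <= psize p.
Proof. by have /andP[] := cpairP p. Qed.

Lemma finite_ncolor_partitions (m : nat) : finite_set (ncolor_partitions m).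
Proof.
pose mult (l : {mset cpart}) (x : nat * nat) := oapp l 0 (insub x : option cpart).
pose code (l : {mset cpart}) : {ffun 'I_m.+1 * 'I_m.+1 -> 'I_m.+1} :=
  [ffun x => inord (mult l (val x.1, val x.2))].
have code_inj : {in ncolor_partitions m &, injective code}.
  move=> l l'; rewrite !inE /ncolor_partitions /= => wl wl' ell'.
  have small (k : {mset cpart}) p : weight k = m -> k p < m.+1.
    move=> <-; rewrite ltnS (leq_trans _ (leq_weight k p))//.
    by rewrite leq_pmulr ?psize_gt0.
  apply/msetP => p; have [pm|mp] := leqP (psize p) m.
    have cm : pcolor p <= m by apply: leq_trans (pcolor_le p) pm.
    have := congr1 (fun f : {ffun 'I_m.+1 * 'I_m.+1 -> 'I_m.+1} =>
      f (inord (psize p), inord (pcolor p))) ell'.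
    rewrite !ffunE /= !inordK// /mult.
    rewrite -[(psize p, pcolor p)]surjective_pairing valK /= => /(congr1 val).
    by rewrite /= !inordK ?small.
  have out (k : {mset cpart}) : weight k = m -> k p = 0.
    move=> wk; apply/eqP; rewrite -leqn0 leqNgt; apply/negP => kp.
    have := leq_weight k p; rewrite wk leqNgt => /negP; apply.
    by rewrite (leq_trans mp)// leq_pmull.
  by rewrite !out.
by rewrite -(eq_finite_set (inj_card_eq code_inj)); exact: finite_finset.
Qed.

Lemma finite_Oset (j r m : nat) : finite_set (Oset j r m).
Proof. by apply: sub_finite_set (finite_ncolor_partitions m) => l []. Qed.

Lemma finite_Dset (j r m : nat) : finite_set (Dset j r m).
Proof. by apply: sub_finite_set (finite_ncolor_partitions m) => l []. Qed.

(* Main.v *)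
Require Import Defs.
From mathcomp Require Import all_boot all_order all_algebra.
From mathcomp Require Import finmap multiset.
From mathcomp Require Import boolp classical_sets functions cardinality fsbigop.
From mathcomp Require Import zify.

(** Let two statistics on the partitions [l] of [m] be given by sets: [B l] is
    the set of parts [p] with [r <= l p], and [C l] the set of parts [p] whose
    dilation [dilate p] (size and color multiplied by [r]) occurs in [l].  As
    dilation is a bijection from the parts onto those with size and color
    divisible by [r], the sets [Dset] and [Oset] are the level sets of [#|B l|]
    and [#|C l|].

    The level sums are read off the polynomials
      [D = sum_l num_parts l X^#|B l|],  [O = sum_l num_parts l X^#|C l|],
      [T = sum_l t l X^#|B l|],
    where [t l] counts the multiplicities strictly between [r] and [2 r], and
    the theorem is the coefficient of [X^j.+1] in [(1 - X) T = X (D - O)].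

    With [y = X - 1], the binomial expansion [X^#|B| = sum_(S <= B) y^#|S|]
    turns a sum over [l] into a sum over pairs of a finite set [S] of parts and
    a partition [l] with [S <= B l].  Removing [r] copies of each part of [S]
    makes [l] an arbitrary partition [mu] of [m - r |S|], where [|S|] is the
    total size of [S].  For [O] one removes one copy of each dilated part of
    [S]; the remainders [mu] are the same ([sum_marked_subsets]).  Hence
      [D = sum_(S, mu) y^#|S| #|S u supp mu|],
      [O = sum_(S, mu) y^#|S| #|dilate S u supp mu|],
    and, since the parts counted by [t] all lie in [B l], marking one of them
    gives
      [y T = X sum_(S, mu) y^#|S| #{p in S | 0 < mu p < r}].
    It remains to see that, for each [S],
      [sum_mu (#{p in S | 0 < mu p < r} + #|S u supp mu|)
         = sum_mu #|dilate S u supp mu|].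
    Subtracting the number of parts of [mu], this says that for [p] in [S] the
    number of [mu] with [mu p < r] equals the number of [mu] with
    [mu (dilate p) = 0]; and indeed removing [r] copies of [p], or one copy of
    [dilate p], shows that the complementary sets are equinumerous
    ([count_remainders_ge]). *)

Set Implicit Arguments.
Unset Strict Implicit.
Unset Printing Implicit Defensive.
Import GRing.Theory.
Local Open Scope mset_scope.
Local Open Scope fset_scope.
Local Open Scope nat_scope.

(** * Sums over finite sets and their subsets *)

Lemma eq_big_fset_pred (R : Type) (idx : R) (op : Monoid.com_law idx)
    (I : choiceType) (A B : {fset I}) (P Q : pred I) (F : I -> R) :
    (forall x, (x \in A) && P x = (x \in B) && Q x) ->
  \big[op/idx]_(x <- A | P x) F x = \big[op/idx]_(x <- B | Q x) F x.
Proof.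
move=> AB; rewrite -big_filter -[RHS]big_filter; apply: perm_big.
apply: uniq_perm; rewrite ?filter_uniq// => x.
by rewrite !mem_filter andbC AB andbC.
Qed.

Lemma card_fset_sep (I : choiceType) (A : {fset I}) (P : pred I) :
  #|` [fset x in A | P x]| = \sum_(x <- A) P x.
Proof.
rewrite card_fset_sum1; transitivity (\sum_(x <- A | P x) 1).
  by apply: eq_big_fset_pred => x; rewrite !inE andbT.
by rewrite big_mkcond; apply: eq_bigr => x _; case: (P x).
Qed.

Section PowersetSums.
Local Open Scope ring_scope.
Context {I : choiceType}.

Lemma big_fpowersetU1 (V : nmodType) (a : I) (B : {fset I})
    (F : {fset I} -> V) : a \notin B ->
  \sum_(S <- fpowerset (a |` B)) F S =
  \sum_(S <- fpowerset B) F S + \sum_(S <- fpowerset B) F (a |` S).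
Proof.
move=> aB; have aS (S : {fset I}) : S \in fpowerset B -> a \notin S.
  by rewrite fpowersetE => /fsubsetP SB; apply: contra aB => /SB.
rewrite -[X in _ = _ + X](big_map (fun S => a |` S) xpredT) -big_cat.
apply: perm_big; apply: uniq_perm.
- by rewrite fset_uniq.
- rewrite cat_uniq fset_uniq map_inj_in_uniq ?fset_uniq ?andbT /=.
    apply/hasPn => _ /mapP[S _ ->]; apply/negP => /aS.
    by rewrite fset1U1.
  move=> S S' /aS aS1 /aS aS2 /(congr1 (fun A => A `\ a)).
  by rewrite !fsetU1K.
- move=> S; rewrite mem_cat fpowersetE; apply/idP/idP.
  + move=> SB; case: (boolP (a \in S)) => aS1; apply/orP; last first.
      left; rewrite fpowersetE; apply/fsubsetP => x xS.
      move/fsubsetP: SB => /(_ _ xS); rewrite !inE => /orP[/eqP xa|//].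
      by rewrite -xa xS in aS1.
    right; apply/mapP; exists (S `\ a); last by rewrite fsetD1K.
    by rewrite fpowersetE fsubDset.
  + case/orP => [|/mapP[S' + ->]]; rewrite fpowersetE.
      by move=> SB; rewrite (fsubset_trans SB)// fsubsetU1.
    exact: fsetUS.
Qed.

(** The binomial theorem, a factor [y] or [1] being chosen at each element. *)
Lemma sum_fpowerset_exp (R : pzRingType) (y : R) (B : {fset I}) :
  \sum_(S <- fpowerset B) y ^+ #|` S| = (y + 1) ^+ #|` B|.
Proof.
elim/fset1U_rect: B => [|a B aB IH].
  by rewrite fpowerset0 big_seq_fset1 cardfs0 !expr0.
rewrite big_fpowersetU1// IH cardfsU1 aB exprS mulrDl mul1r addrC.
congr (_ + _); rewrite -IH mulr_sumr big_seq [RHS]big_seq.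
apply: eq_bigr => S; rewrite fpowersetE => /fsubsetP SB.
by rewrite cardfsU1 (contra (SB a) aB) exprS.
Qed.

(** Forcing [a] into [S] replaces one factor [y + 1] by [y]; both sides are
    multiplied by [y + 1] so that no predecessor of [#|B|] appears. *)
Lemma sum_fpowerset_exp_mem (R : pzRingType) (y : R) (B : {fset I}) (a : I) :
    a \in B ->
  y * (y + 1) ^+ #|` B| =
  (y + 1) * \sum_(S <- fpowerset B) y ^+ #|` S| *+ (a \in S).
Proof.
move=> aB; rewrite -(fsetD1K aB).
have aB' : a \notin B `\ a by rewrite !inE eqxx.
have aS (S : {fset I}) : S \in fpowerset (B `\ a) -> a \notin S.
  by rewrite fpowersetE => /fsubsetP SB; apply: contra aB' => /SB.
rewrite big_fpowersetU1// big_seq big1 ?add0r; last first.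
  by move=> S /aS /negPf ->.
rewrite cardfsU1 aB' /= exprS mulrA.
have -> : y * (y + 1) = (y + 1) * y by rewrite mulrDl mulrDr mul1r mulr1.
rewrite -mulrA -sum_fpowerset_exp mulr_sumr; congr (_ * _).
rewrite big_seq [RHS]big_seq; apply: eq_bigr => S /aS aS'.
by rewrite cardfsU1 fset1U1 aS' exprS.
Qed.

(** Double counting of the pairs of a subset [S] of [B] and an element of [S]
    that satisfies [Q]. *)
Lemma sum_fpowerset_exp_count (R : pzRingType) (y : R) (B : {fset I})
    (Q : pred I) :
  (y * (y + 1) ^+ #|` B|) *+ (\sum_(p <- B) Q p)%N =
  (y + 1) * \sum_(S <- fpowerset B) y ^+ #|` S| *+ (\sum_(p <- S) Q p)%N.
Proof.
have count S : S \in fpowerset B ->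
    (\sum_(p <- S) Q p = \sum_(p <- B) (p \in S) * Q p)%N.
  rewrite fpowersetE => SB.
  rewrite -[RHS](big_fset_incl _ SB) => [|p _ /negPf -> //].
  by rewrite big_seq [RHS]big_seq; apply: eq_bigr => p ->; rewrite mul1n.
transitivity ((y + 1) * \sum_(S <- fpowerset B)
    \sum_(p <- B) (y ^+ #|` S| *+ (p \in S)) *+ Q p); last first.
  congr (_ * _); rewrite big_seq [RHS]big_seq; apply: eq_bigr => S SB.
  by rewrite count// -sumrMnr; apply: eq_bigr => p _; rewrite mulrnA.
rewrite exchange_big -sumrMnr mulr_sumr big_seq [RHS]big_seq.
apply: eq_bigr => p pB.
by rewrite sumrMnl mulrnAr -sum_fpowerset_exp_mem.
Qed.

End PowersetSums.

(** * Removing a sub-multiset from the partitions of an integer *)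

Lemma weight_fsubE (l : {mset cpart}) (V : {fset cpart}) :
  finsupp l `<=` V -> weight l = \sum_(p <- V) l p * psize p.
Proof.
move=> lV; rewrite weightE; apply: big_fset_incl => // p _ pl.
by rewrite fsfun_dflt.
Qed.

Lemma weightD (l k : {mset cpart}) : weight (l `+` k) = weight l + weight k.
Proof.
rewrite (@weight_fsubE l (finsupp (l `+` k))).
  rewrite (@weight_fsubE k (finsupp (l `+` k))).
    rewrite weightE -big_split/=; apply: eq_bigr => p _.
    by rewrite msetE2 mulnDl.
  by apply/fsubsetP => p; rewrite !msuppE !in_mset msetE2; lia.
by apply/fsubsetP => p; rewrite !msuppE !in_mset msetE2; lia.
Qed.

Lemma finite_remainders (m k : nat) :
  finite_set ([set l | weight l + k = m]%classic : set {mset cpart}).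
Proof.
apply: sub_finite_set (finite_ncolor_partitions (m - k)) => l /= <-.
by rewrite /ncolor_partitions /= addnK.
Qed.

(** The equation [weight l + k = m], rather than [weight l = m - k], makes this
    set empty when [m < k]: then no partition of [m] contains a sub-multiset of
    weight [k]. *)
Definition remainders (m k : nat) : {fset {mset cpart}} :=
  fset_set [set l | weight l + k = m]%classic.

Lemma in_remainders m k l : (l \in remainders m k) = (weight l + k == m).
Proof.
rewrite in_fset_set; last exact: finite_remainders.
by apply/idP/eqP; rewrite inE.
Qed.

Lemma sum_remainders_shift (V : nmodType) (m k : nat) (nu : {mset cpart})
    (F : {mset cpart} -> V) :
  (\sum_(l <- remainders m k | (nu `<=` l)%mset) F l =
   \sum_(mu <- remainders m (weight nu + k)) F (mu `+` nu)%mset)%R.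
Proof.
rewrite -[RHS](big_map (fun mu => (mu `+` nu)%mset) xpredT F) -[LHS]big_filter.
apply: perm_big; apply: uniq_perm.
- by rewrite filter_uniq.
- rewrite map_inj_uniq ?fset_uniq// => a b.
  by move=> /(congr1 (fun A => (A `\` nu)%mset)); rewrite !msetDKBC.
- move=> l; rewrite mem_filter in_remainders; apply/idP/mapP.
  + move=> /andP[nul wl]; exists (l `\` nu)%mset; last by rewrite msetBDK.
    by rewrite in_remainders addnA -weightD msetBDK.
  + move=> [mu + ->]; rewrite in_remainders addnA weightD => ->.
    by rewrite andbT; apply/msubsetP => p; rewrite msetE2 leq_addl.
Qed.

(** * Marking a set of parts in a partition *)

Definition copies (n : nat) (g : cpart -> cpart) (S : {fset cpart}) :
  {mset cpart} := [fsfun q in g @` S => n].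

Definition total_size (S : {fset cpart}) : nat := \sum_(p <- S) psize p.

(** Two instances matter: [n = r] with [g] the identity, and [n = 1] with [g] the
    dilation by [r].  They share the value [r * psize p] of the weight removed
    for a marked part [p]. *)
Section Copies.
Variables (r n : nat) (g : cpart -> cpart).
Hypotheses (g_inj : injective g) (n_gt0 : 0 < n).
Hypothesis size_g : forall p, n * psize (g p) = r * psize p.

Lemma copiesE (S : {fset cpart}) (q : cpart) :
  copies n g S q = if q \in g @` S then n else 0.
Proof. by rewrite /copies fsfunE. Qed.

Lemma finsupp_copies S : finsupp (copies n g S) = g @` S.
Proof.
apply/fsetP => q; rewrite msuppE in_mset copiesE.
by case: ifP => // _; rewrite n_gt0.
Qed.

Lemma weight_copies S : weight (copies n g S) = r * total_size S.
Proof.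
rewrite weightE finsupp_copies big_imfset/=; last by move=> ? ? _ _ /g_inj.
rewrite /total_size big_distrr/= big_seq [RHS]big_seq.
by apply: eq_bigr => p pS; rewrite copiesE in_imfset.
Qed.

Lemma copies_sub S l :
  (copies n g S `<=` l)%mset = [forall p : S, n <= l (g (val p))].
Proof.
apply/msubsetP/forallP => [Sl p|Sl q].
  by have := Sl (g (val p)); rewrite copiesE in_imfset//= (valP p).
rewrite copiesE; case: ifP => // /imfsetP[p /= pS ->].
exact: (Sl [` pS]).
Qed.

Definition marked (U : {fset cpart}) (l : {mset cpart}) : {fset cpart} :=
  [fset p in U | n <= l (g p)].

Lemma sub_marked U l S :
  (S `<=` marked U l) = (S `<=` U) && (copies n g S `<=` l)%mset.
Proof.
rewrite copies_sub; apply/fsubsetP/andP => [SU|[/fsubsetP SU /forallP Sl] p pS].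
  split; first by apply/fsubsetP => p /SU; rewrite !inE => /andP[].
  by apply/forallP => p; have := SU _ (valP p); rewrite !inE => /andP[].
by rewrite !inE SU//=; exact: (Sl [` pS]).
Qed.

(** The right-hand side depends on [(n, g)] only through the summand, which is
    what allows the two instances to be compared. *)
Lemma sum_marked_subsets (V : nmodType) m U (F : {fset cpart} -> {mset cpart} -> V) :
  (\sum_(l <- remainders m 0) \sum_(S <- fpowerset (marked U l)) F S l =
   \sum_(S <- fpowerset U) \sum_(mu <- remainders m (r * total_size S))
      F S (mu `+` copies n g S)%mset)%R.
Proof.
have E l : (\sum_(S <- fpowerset (marked U l)) F S l =
            \sum_(S <- fpowerset U | (copies n g S `<=` l)%mset) F S l)%R.
  by apply: eq_big_fset_pred => S; rewrite andbT !fpowersetE sub_marked.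
under eq_bigr do rewrite E big_mkcond/=.
rewrite exchange_big/=; apply: eq_bigr => S _.
by rewrite -big_mkcond/= sum_remainders_shift weight_copies addn0.
Qed.

Lemma sum_marked_exp (R : pzRingType) (y : R) m U (f : {mset cpart} -> nat) :
  (\sum_(l <- remainders m 0) (y + 1) ^+ #|` marked U l| *+ f l =
   \sum_(S <- fpowerset U) y ^+ #|` S| *+
     (\sum_(mu <- remainders m (r * total_size S))
        f (mu `+` copies n g S)%mset)%N)%R.
Proof.
under eq_bigr do rewrite -sum_fpowerset_exp -sumrMnl.
rewrite sum_marked_subsets.
by apply: eq_bigr => S _; rewrite sumrMnr.
Qed.

(** Since [Q] is tested on elements of [marked U l] only, the element that it
    counts can be forced into [S], at the price of a factor [y / (y + 1)]. *)
Lemma sum_marked_exp_count (R : comPzRingType) (y : R) m U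
    (Q : {mset cpart} -> pred cpart) :
  (y * (\sum_(l <- remainders m 0)
          (y + 1) ^+ #|` marked U l| *+ (\sum_(p <- marked U l) Q l p)%N) =
   (y + 1) * \sum_(S <- fpowerset U) y ^+ #|` S| *+
     (\sum_(mu <- remainders m (r * total_size S))
        \sum_(p <- S) Q (mu `+` copies n g S)%mset p)%N)%R.
Proof.
rewrite mulr_sumr.
under eq_bigr do rewrite mulrnAr sum_fpowerset_exp_count.
rewrite -mulr_sumr sum_marked_subsets; congr (_ * _)%R.
by apply: eq_bigr => S _; rewrite sumrMnr.
Qed.

(** Taking [n] copies of [g p] away loses weight [r * psize p], whatever [n] and
    [g] are: hence [r <= mu p] and [0 < mu (dilate p)] hold equally often. *)
Lemma count_remainders_ge m k p :
  \sum_(mu <- remainders m k) (n <= mu (g p)) =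
  \sum_(mu <- remainders m (r * psize p + k)) 1.
Proof.
have := sum_remainders_shift m k (copies n g [fset p]) (fun=> 1).
rewrite weight_copies /total_size big_seq_fset1 => <-.
rewrite [RHS]big_mkcond/=; apply: eq_bigr => mu _.
rewrite copies_sub.
suff -> : [forall q : [fset p], n <= mu (g (val q))] = (n <= mu (g p)).
  by case: leqP.
apply/forallP/idP => [/(_ [` fset11 p])//|H q].
by have := valP q; rewrite inE => /eqP ->.
Qed.

Lemma num_parts_copies mu S :
  num_parts (mu `+` copies n g S) = num_parts mu + \sum_(p <- S) (mu (g p) == 0).
Proof.
rewrite /num_parts -card_fset_sep.
have <- : #|` g @` [fset p in S | mu (g p) == 0]| =
          #|` [fset p in S | mu (g p) == 0]| by rewrite card_imfset.
rewrite (_ : finsupp _ = finsupp mu `|` g @` [fset p in S | mu (g p) == 0]).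
  rewrite cardfsU (_ : _ `&` _ = fset0) ?cardfs0 ?subn0//.
  apply/fsetP => q; rewrite !inE; apply/negP => /andP[+ /imfsetP[p /= + qE]].
  by rewrite !inE qE msuppE -mset_neq0 => /negPf -> /andP[].
apply/fsetP => q; rewrite inE !msuppE !in_mset msetE2 copiesE addn_gt0.
case: (posnP (mu q)) => //= q0; apply/idP/imfsetP => /=.
  case: ifP => // /imfsetP[p /= pS qE] _; exists p => //.
  by rewrite !inE pS -qE q0.
by move=> [p]; rewrite !inE => /andP[pS _] ->; rewrite in_imfset.
Qed.

End Copies.

(** * Dilation of colored parts *)

Section Dilation.
Variables (r : nat) (r_gt0 : 0 < r).

Lemma dilate_proof (p : cpart) :
  0 < (r * psize p, r * pcolor p).2 <= (r * psize p, r * pcolor p).1.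
Proof.
have /andP[c0 cs] := cpairP p.
by rewrite /= muln_gt0 r_gt0 c0 leq_mul2l cs orbT.
Qed.

Definition dilate (p : cpart) : cpart := CPart (dilate_proof p).

Lemma dilate_inj : injective dilate.
Proof.
move=> p q /(congr1 val) [] /eqP + /eqP; rewrite !eqn_pmul2l// => /eqP s /eqP c.
apply: val_inj; rewrite /= [LHS]surjective_pairing [RHS]surjective_pairing.
by congr pair.
Qed.

Lemma dilateP (q : cpart) :
  reflect (exists p, q = dilate p) ((r %| psize q) && (r %| pcolor q)).
Proof.
apply: (iffP andP) => [[/dvdnP[a sq] /dvdnP[b cq]]|[p ->]]; last first.
  by rewrite !dvdn_mulr.
have ab : 0 < (a, b).2 <= (a, b).1.
  have := cpairP q; rewrite -/(psize q) -/(pcolor q) sq cq /=.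
  by rewrite muln_gt0 r_gt0 andbT leq_pmul2r.
exists (CPart ab); apply: val_inj => /=.
by rewrite [LHS]surjective_pairing [r * _]mulnC -sq [r * _]mulnC -cq.
Qed.

(** Both sides count the parts of [mu] once, so the comparison is made for each
    [p] in [S] separately: after adding the number of [mu] with [r <= mu p], which
    is also the number of [mu] containing [dilate p], each side becomes the number
    of all [mu]. *)
Lemma sum_num_parts_copies m k (S : {fset cpart}) :
  \sum_(mu <- remainders m k)
     \sum_(p <- S) (r < (mu `+` copies r id S) p < 2 * r) +
  \sum_(mu <- remainders m k) num_parts (mu `+` copies r id S) =
  \sum_(mu <- remainders m k) num_parts (mu `+` copies 1 dilate S).
Proof.
under [X in _ + X]eq_bigr do rewrite (num_parts_copies (@inj_id _))//.
under [RHS]eq_bigr do rewrite (num_parts_copies dilate_inj)//.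
rewrite !big_split/= addnCA; congr (_ + _).
rewrite exchange_big/= [X in _ + X]exchange_big/= [RHS]exchange_big/=.
rewrite -big_split/= big_seq [RHS]big_seq; apply: eq_bigr => p pS.
have D := @count_remainders_ge r r id (@inj_id _) r_gt0 (fun=> erefl) m k p.
have O := @count_remainders_ge r 1 dilate dilate_inj isT
  (fun q => mul1n (r * psize q)) m k p.
apply/(@addnI (\sum_(mu <- remainders m k) (r <= mu p))).
rewrite [in RHS]D -O -!big_split/=; apply: eq_bigr => mu _.
rewrite msetE2 copiesE imfset_id pS.
by move: (mu (dilate p)) (mu p) => a b; clear -r_gt0; lia.
Qed.

End Dilation.

(** * The generating polynomials of the two families *)

(** Subsets of [marked] sets are summed over one index set common to all
    partitions of [m]; these have only parts of size at most [m]. *)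
Lemma finite_small_parts (m : nat) :
  exists U : {fset cpart}, forall p, psize p <= m -> p \in U.
Proof.
exists [fset p in pmap insub [seq (n, i) | n <- iota 0 m.+1, i <- iota 0 m.+1]].
move=> p pm; rewrite inE mem_pmap_sub [\val p]surjective_pairing.
apply: (allpairs_f pair); rewrite mem_iota add0n ltnS//.
by rewrite (leq_trans (pcolor_le p)).
Qed.

Lemma sum_stratum (m j : nat) (A : set {mset cpart}) (d f : {mset cpart} -> nat) :
    (forall l, A l <-> ncolor_partitions m l /\ d l = j) ->
  (\sum_(l \in A) (f l)%:Z)%R =
  ((\sum_(l <- remainders m 0) ('X^(d l) *+ f l : {poly int})) `_ j)%R.
Proof.
move=> AE; rewrite fsbig_finite/=; last first.
  by apply: sub_finite_set (finite_ncolor_partitions m) => l /AE[].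
rewrite coef_sum [RHS](eq_bigr (fun l => if d l == j then (f l)%:Z else 0)%R); last first.
  move=> l _; rewrite coefMn coefXn eq_sym; case: eqP => _ /=.
    by rewrite natz.
  by rewrite mul0rn.
rewrite -big_mkcond/=; apply: eq_big_fset_pred => l.
rewrite andbT in_remainders addn0 in_fset_set; last first.
  by apply: sub_finite_set (finite_ncolor_partitions m) => ? /AE[].
apply/idP/andP; rewrite inE; first by move=> /AE[-> ->].
by move=> [/eqP wl /eqP dl]; apply/AE.
Qed.

Section MarkedStatistics.
Variables (r m : nat) (r_gt0 : 0 < r) (U : {fset cpart}).
Hypothesis in_U : forall p, psize p <= m -> p \in U.
Let big := marked r id U.
Let dilated := marked 1 (dilate r_gt0) U.

Lemma part_in_U (l : {mset cpart}) (p : cpart) :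
  weight l = m -> 0 < l p -> p \in U.
Proof.
move=> wl lp; apply: in_U; rewrite -wl.
by rewrite (leq_trans _ (leq_weight l p))// leq_pmull.
Qed.

Lemma DsetE (j : nat) (l : {mset cpart}) :
  Dset j r m l <-> ncolor_partitions m l /\ #|` big l| = j.
Proof.
have E : weight l = m -> big l = [fset p in finsupp l | r <= l p].
  move=> wl; apply/fsetP => p; rewrite !inE msuppE in_mset.
  case: (leqP r (l p)) => [rp|]; last by rewrite !andbF.
  have lp := leq_trans r_gt0 rp.
  by rewrite lp (part_in_U wl lp).
by split=> -[wl <-]; split=> //; rewrite E.
Qed.

Lemma OsetE (j : nat) (l : {mset cpart}) :
  Oset j r m l <-> ncolor_partitions m l /\ #|` dilated l| = j.
Proof.
have E : weight l = m ->
    [fset q in finsupp l | (r %| psize q) && (r %| pcolor q)] =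
    dilate r_gt0 @` dilated l.
  move=> wl; apply/fsetP => q; rewrite !inE msuppE in_mset.
  apply/andP/imfsetP => [[lq /(dilateP r_gt0)[p qE]]|[p /=]].
    exists p => //=; rewrite !inE -qE lq andbT; apply: in_U.
    have -> : psize p = psize q %/ r by rewrite qE mulKn.
    rewrite -wl (leq_trans (leq_div _ _))//.
    by rewrite (leq_trans _ (leq_weight l q))// leq_pmull.
  rewrite !inE => /andP[_ lp] ->; split=> //.
  by apply/(dilateP r_gt0); exists p.
have dil_inj := @dilate_inj r r_gt0.
by split=> -[wl <-]; split=> //; rewrite E ?card_imfset.
Qed.

Lemma TnumE (j : nat) :
  Tnum j r m =
  ((\sum_(l <- remainders m 0)
     'X^#|` big l| *+ (\sum_(p <- big l) (r < l p < 2 * r))%N)`_j)%R.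
Proof.
rewrite /Tnum (sum_stratum _ (DsetE j)).
apply: (congr1 (fun q : {poly int} => q`_j)%R).
rewrite big_seq [RHS]big_seq; apply: eq_bigr => l.
rewrite in_remainders addn0 => /eqP wl; congr (_ *+ _)%R.
rewrite -card_fset_sep; congr #|` _|; apply/fsetP => p.
rewrite !inE msuppE in_mset.
case: (boolP (r < l p < 2 * r)) => [/andP[rp _]|_]; last by rewrite !andbF.
have lp : 0 < l p := leq_ltn_trans (leq0n r) rp.
by rewrite lp (part_in_U wl lp) (ltnW rp).
Qed.

End MarkedStatistics.

Local Open Scope ring_scope.

Theorem theorem4p1 (r m j : nat) (hr : (2 <= r)%N) :
  Tnum j.+1 r m - Tnum j r m =
    (\sum_(l \in Dset j r m) (num_parts l)%:Z)
    - (\sum_(l \in Oset j r m) (num_parts l)%:Z).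
Proof.
have r_gt0 : (0 < r)%N by apply: leq_trans hr.
have [U in_U] := finite_small_parts m; pose dil := dilate r_gt0.
have dil_inj : injective dil := @dilate_inj r r_gt0.
rewrite (sum_stratum num_parts (DsetE r_gt0 in_U j)).
rewrite (sum_stratum num_parts (OsetE r_gt0 in_U j)) !(TnumE r_gt0 in_U).
set T := \sum_(l <- _) _; set D := \sum_(l <- _) _; set O := \sum_(l <- _) _.
pose y : {poly int} := 'X - 1; have yX : y + 1 = 'X by rewrite subrK.
have DE := sum_marked_exp (@inj_id _) r_gt0 (fun=> erefl) y m U num_parts.
have OE := sum_marked_exp dil_inj (ltn0Sn 0) (fun p => mul1n (r * psize p))
  y m U num_parts.
have TE := sum_marked_exp_count (@inj_id _) r_gt0 (fun=> erefl) y m U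
  (fun l p => r < l p < 2 * r)%N.
rewrite yX in DE; rewrite yX in OE; rewrite yX -/T in TE.
set T' := \sum_(S <- _) _ in TE.
have TDO : T' + D = O.
  rewrite [D]DE [O]OE -big_split/=; apply: eq_bigr => S _.
  by rewrite -mulrnDr sum_num_parts_copies.
(* Multiplying by 'X shifts T`_j and (D - O)`_j to index j.+1, so a single
   identity of polynomials remains and the case j = 0 is not special. *)
have -> : T`_j = ('X * T)`_j.+1 by rewrite coefXM.
rewrite -!coefB.
have -> : (D - O)`_j = ('X * (D - O))`_j.+1 by rewrite coefXM.
congr (_`_j.+1).
have -> : T - 'X * T = - (y * T) by rewrite mulrBl mul1r opprB.
by rewrite TE -TDO opprD addrA [D - _]addrC addrK mulrN.
Qed.
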